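(* Consider the $(\mathsf H,r,M,N)$ combination network with end-user-caches, with $K=\binom{\mathsf H}{r}$ users. For $t\in\{0,\dots,K\}$ let $$\mathcal V_1=\mathcal V_1(t)=\{\mathcal J\subseteq[K]:|\mathcal J|=t+1,\ \mathcal R_{\mathcal J}\neq\emptyset\},\qquad \mathcal V_2=\mathcal V_2(t)=\{\mathcal J\subseteq[K]:|\mathcal J|=t+1,\ \mathcal R_{\mathcal J}=\emptyset\}.$$ Then, as a function of $M\in[0,N]$, the optimal max-link load under uncoded cache placement $R^\star_{\mathrm u}(M)$ is upper bounded by the lower convex envelope of the following (memory, load) points: (i) $\left(\frac{Nt}{K},R_{\mathrm{DIS}}[t]\right)$ for each $t\in\{0,\dots,K\}$, where $$R_{\mathrm{DIS}}[t]=\frac{\sum_{\mathcal J_1\in\mathcal V_1}1+\sum_{\mathcal J_2\in\mathcal V_2}\frac1r\,\bigl|\{h\in[\mathsf H]:\mathcal U_h\cap\mathcal J_2\neq\emptyset\}\bigr|}{\mathsf H\binom{K}{t}};$$ (ii) $\left(\frac NK,R_{\mathrm{IES}}\right)$ with $$R_{\mathrm{IES}}=\frac{1}{2\mathsf H}\left(K-1-\binom{\mathsf H-r}{r}\right)+\frac{\binom{2r-1}{r-1}}{(2r-1)K}\binom{\mathsf H-1}{2r-1},$$ provided $2r-1=p^{v}$ or $2r-1=pq$, where $p,q$ are different primes and $v$ is a positive integer; (iii) $\left(\frac{Nt}{K},R_{\mathrm{CICS}}[t]\right)$ for each $t\in\{0,\dots,K\}$, where $$R_{\mathrm{CICS}}[t]=\sum_{\mathcal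 J\subseteq[K]:|\mathcal J|=t+1}\frac{1+\min_{h\in[\mathsf H]}|\mathcal J\setminus\mathcal U_h|/r}{\mathsf H\binom Kt}\ \le\ \binom{K}{t+1}\frac{1+t/r}{\mathsf H\binom Kt}.$$
   Context: Notation: $[n]=\{1,\dots,n\}$; $\binom ab=0$ if $a<b$. Network. An $(\mathsf H,r,M,N)$ combination network with end-user-caches ($1\le r\le\mathsf H$, $0\le M\le N$) has one server with $N$ files $F_1,\dots,F_N$, each consisting of $B$ independent uniform bits (files mutually independent), $\mathsf H$ relays without caches, and $K=\binom{\mathsf H}{r}$ users, each connected to a distinct $r$-subset of the relays. The server is connected to every relay. All links are error-free and interference-free. $\mathcal U_h\subseteq[K]$ is the set of users connected to relay $h$, $\mathcal H_k\subseteq[\mathsf H]$ the set of relays connected to user $k$, and $\mathcal R_{\mathcal W}=\{h\in[\mathsf H]:\mathcal W\subseteq\mathcal U_h\}$ the set of relays connected to all users in $\mathcal W\subseteq[K]$. Scheme. In the placement phase user $k$ stores a content $Z_k$ of at most $MB$ bits (a function of the files) without knowing the demands. The placement is uncoded if each $Z_k$ consists of bits copied directly from the files. In the delivery phase user $k$ demands $F_{d_k}$, $d_k\in[N]$; the demand vector $\mathbf d=(d_1,\dots,d_K)$ is known to all nodes. The server sends to relay $h$ a message $X_h$ of $B R_h(\mathbf d)$ bits, and relay $h$ sends to each user $k\in\mathcal U_h$ a message $X_{h\to k}$ (a function of $X_h$) of $B R_{h\to k}(\mathbf d)$ bits. User $k$ must recover $F_{d_k}$ from $Z_k$ and $(X_{h\to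 k}:h\in\mathcal H_k)$ with high probability. The max-link load of a scheme is $\max_{h,\,k\in\mathcal U_h,\,\mathbf d\in[N]^K}\max\{R_h(\mathbf d),R_{h\to k}(\mathbf d)\}$. A load $R$ is achievable for memory $M$ if there is a sequence of schemes with file sizes $B\to\infty$, error probability tending to $0$ and max-link load with limsup at most $R$. $R^\star_{\mathrm u}(M)$ is the minimum load achievable with uncoded placement. *)

(* Defs.v *)
From HB Require Import structures.
From mathcomp Require Import all_boot all_order all_algebra.
From mathcomp Require Import all_classical all_reals all_analysis.

Set Implicit Arguments.
Unset Strict Implicit.
Unset Printing Implicit Defensive.

Import Order.TTheory GRing.Theory Num.Theory.
Import numFieldNormedType.Exports.

Local Open Scope classical_set_scope.
Local Open Scope ring_scope.

(* A network is given by [conn : 'I_K -> {set 'I_H}], where [conn k] is the set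
   H_k of relays connected to user k; [comb_network r conn] says that the users
   are in bijection with the r-subsets of the relays. *)
Definition comb_network (H r : nat) (conn : 'I_('C(H, r)) -> {set 'I_H}) :=
  injective conn /\ forall k, #|conn k| = r.

Section Network.
Variables (H K : nat) (conn : 'I_K -> {set 'I_H}).

(* U_h *)
Definition users_of (h : 'I_H) : {set 'I_K} := [set k | h \in conn k]%SET.

(* R_W *)
Definition relays_of_all (W : {set 'I_K}) : {set 'I_H} :=
  [set h | W \subset users_of h]%SET.

End Network.

(* N files of B bits each *)
Definition files (N B : nat) := {ffun 'I_N -> B.-tuple bool}.

Definition demands (K N : nat) := {ffun 'I_K -> 'I_N}.

Section Scheme.
Variables (H K : nat) (conn : 'I_K -> {set 'I_H}) (N B : nat).

(* The placement does not depend on the demands. The lengths (in bits) of the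
   messages may depend on the demands, but not on the content of the files.
   The decoder of user k only receives the messages of the relays in
   [conn k]. *)
Record scheme := Scheme {
  cache_len : 'I_K -> nat;
  cache : forall k : 'I_K, files N B -> (cache_len k).-tuple bool;
  relay_len : demands K N -> 'I_H -> nat;
  relay_msg : forall (d : demands K N) (h : 'I_H),
    files N B -> (relay_len d h).-tuple bool;
  link_len : demands K N -> 'I_H -> 'I_K -> nat;
  link_msg : forall (d : demands K N) (h : 'I_H) (k : 'I_K),
    (relay_len d h).-tuple bool -> (link_len d h k).-tuple bool;
  decode : forall (d : demands K N) (k : 'I_K), (cache_len k).-tuple bool ->
    (forall h : 'I_H, h \in conn k -> (link_len d h k).-tuple bool) ->
    B.-tuple bool
}.

Definition decoded (s : scheme) (d : demands K N) (F : files N B) (k : 'I_K) :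
    B.-tuple bool :=
  decode (s := s) (d := d) (cache s k F)
    (fun h (_ : h \in conn k) => link_msg k (relay_msg s d h F)).

(* every cached bit is a copy of bit number p.2 of file number p.1,
   at a position p independent of the content of the files *)
Definition uncoded_placement (s : scheme) : Prop :=
  forall k : 'I_K, exists pos : 'I_(cache_len s k) -> 'I_N * 'I_B,
    forall (F : files N B) (i : 'I_(cache_len s k)),
      tnth (cache s k F) i = tnth (F (pos i).1) (pos i).2.

Variable R : realType.

Definition memory_ok (M : R) (s : scheme) : Prop :=
  forall k : 'I_K, (cache_len s k)%:R <= M * B%:R.

(* worst case over the demands of the probability, for uniformly distributed
   files, that some user does not recover its file *)
Definition error_prob (s : scheme) : R :=
  \big[Num.max/0]_(d : demands K N)
    (#|[set F : files N B | [exists k, decoded s d F k != F (d k)]]%SET|%:R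
       / #|{: files N B}|%:R).

Definition max_link_load (s : scheme) : R :=
  \big[Num.max/0]_(d : demands K N) \big[Num.max/0]_(h < H)
    \big[Num.max/0]_(k in users_of conn h)
      Num.max ((relay_len s d h)%:R / B%:R) ((link_len s d h k)%:R / B%:R).

End Scheme.

Section Optimum.
Variables (R : realType) (H K : nat) (conn : 'I_K -> {set 'I_H}) (N : nat).

Definition achievable_uncoded (M L : R) : Prop :=
  exists (B : nat -> nat) (s : forall n, scheme conn N (B n)),
    [/\ B n @[n --> \oo] --> \oo,
        forall n, uncoded_placement (s n) /\ memory_ok M (s n),
        (error_prob R (s n) : R) @[n --> \oo] --> (0 : R) &
        (limn_esup (fun n => (max_link_load R (s n))%:E) <= L%:E)%E].

(* R*_u(M); the infimum is taken in \bar R so that it would be +oo if no load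
   were achievable *)
Definition opt_load_uncoded (M : R) : \bar R :=
  ereal_inf [set L%:E | L in [set L : R | achievable_uncoded M L]].

End Optimum.

(* Lower boundary of the convex hull of a set P of points of the plane
   (+oo at the abscissas outside of the projection of the hull). *)
Definition lower_convex_envelope (R : realType) (P : set (R * R)) (x : R) :
    \bar R :=
  ereal_inf [set y%:E | y in [set y : R |
    exists (n : nat) (w : 'I_n -> R) (p : 'I_n -> R * R),
      [/\ forall i, 0 <= w i /\ P (p i),
          \sum_(i < n) w i = 1,
          \sum_(i < n) w i * (p i).1 = x &
          \sum_(i < n) w i * (p i).2 = y]]].

Section Loads.
Variables (R : realType) (H r K : nat) (conn : 'I_K -> {set 'I_H}).

Definition V1 (t : nat) : {set {set 'I_K}} :=
  [set J : {set 'I_K} | (#|J| == t.+1) && (relays_of_all conn J != finset.set0)]%SET.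

Definition V2 (t : nat) : {set {set 'I_K}} :=
  [set J : {set 'I_K} | (#|J| == t.+1) && (relays_of_all conn J == finset.set0)]%SET.

Definition R_DIS (t : nat) : R :=
  (\sum_(J in V1 t) 1
   + \sum_(J in V2 t)
       r%:R^-1 * #|[set h : 'I_H | users_of conn h :&: J != finset.set0]%SET|%:R)
  / (H%:R * 'C(K, t)%:R).

Definition R_IES : R :=
  (2 * H%:R)^-1 * (K%:R - 1 - 'C(H - r, r)%:R)
  + 'C(2 * r - 1, r - 1)%:R / ((2 * r - 1)%:R * K%:R)
    * 'C(H - 1, 2 * r - 1)%:R.

Definition IES_condition : Prop :=
  (exists p v : nat, [/\ prime p, (0 < v)%N & (2 * r - 1 = p ^ v)%N]) \/
  (exists p q : nat, [/\ prime p, prime q, p != q & (2 * r - 1 = p * q)%N]).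

(* min over h of |J \ U_h|; the default value #|J| is an upper bound of all the
   terms, so it is harmless as soon as H > 0 *)
Definition min_outside (J : {set 'I_K}) : nat :=
  (\big[minn/#|J|]_(h < H) #|J :\: users_of conn h|)%N.

Definition R_CICS (t : nat) : R :=
  \sum_(J : {set 'I_K} | #|J| == t.+1)
    (1 + (min_outside J)%:R / r%:R) / (H%:R * 'C(K, t)%:R).

Definition memory_load_points (N : nat) : set (R * R) :=
  [set p | exists2 t : nat, (t <= K)%N &
             p = (N%:R * t%:R / K%:R, R_DIS t)]
  `|` [set p | IES_condition /\ p = (N%:R / K%:R, R_IES)]
  `|` [set p | exists2 t : nat, (t <= K)%N &
             p = (N%:R * t%:R / K%:R, R_CICS t)].

End Loads.

(* Main.v *)
(* All the schemes use the placement of Maddah-Ali and Niesen with integer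
   parameters t, and send integer linear combinations of the multicast messages
   W_J = \sum_(k in J) F_(d_k, J \ k) for |J| = t + 1, where blocks of L bits are
   read as integers: fixed coefficients cost O(1) extra bits per block, which is
   negligible as L grows, so only linear algebra over the integers matters.
   Splitting the files proportionally to the weights of a convex combination
   gives memory sharing.

   The loads of the relays are balanced by averaging over all permutations of
   the relays. Thus only the total number of combinations spent on each W_J
   counts: 1 if some relay is connected to all of J, and otherwise the number of
   relays touching J over r (MDS code), 1 + |J \ U_h| / r for any relay h (inner
   code), or 2r / (2r - 1) for t = 1 (interference elimination). Because of the
   averaging, the last cost needs only one basis made of balanced bipartitions
   of 2r relays, not a partition of all bipartitions into such bases. *)
Require Import Defs.
From mathcomp Require Import all_boot all_order all_algebra fingroup perm.
From mathcomp Require Import all_classical all_reals all_analysis.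
From mathcomp Require Import ring lra zify.
Import Order.TTheory GRing.Theory Num.Theory.
Import numFieldNormedType.Exports.
Local Open Scope ring_scope.

Set Implicit Arguments.
Unset Strict Implicit.
Unset Printing Implicit Defensive.

(** * Bit strings, decoders and linear codes *)

Definition bits_of (T : finType) (g : T -> bool) : #|T|.-tuple bool :=
  [tuple g (enum_val j) | j < #|T|].

Lemma bits_of_inj (T : finType) (g g' : T -> bool) :
  bits_of g = bits_of g' -> g =1 g'.
Proof.
move=> e x; have := congr1 (fun u => tnth u (enum_rank x)) e.
by rewrite !tnth_mktuple enum_rankK.
Qed.

(** The shift by [2 ^ n] makes values with [|v| < 2 ^ n] nonnegative and below [2 ^ n.+1], so that
    they index the strings of n + 1 bits. Only injectivity matters. *)
Definition int_bits n (v : int) : {ffun 'I_n.+1 -> bool} :=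
  nth [ffun=> false] (enum {ffun 'I_n.+1 -> bool}) (absz (v + (2 ^ n)%N%:Z)).

Lemma int_bits_inj n (u v : int) : `|u| < (2 ^ n)%N%:Z -> `|v| < (2 ^ n)%N%:Z ->
  int_bits n u = int_bits n v -> u = v.
Proof.
move=> hu hv /eqP; have sz : size (enum {ffun 'I_n.+1 -> bool}) = (2 ^ n * 2)%N.
  by rewrite -cardE card_ffun card_bool card_ord expnSr.
rewrite nth_uniq ?enum_uniq ?sz; lia.
Qed.

(** Relays forward their whole message, and a user reads its file in any file family consistent with
    what it sees; the hypothesis makes all these choices agree. *)
Lemma unique_decoding_scheme (H K N B : nat) (conn : 'I_K -> {set 'I_H})
    (clen : 'I_K -> nat) (c : forall k, files N B -> (clen k).-tuple bool)
    (rlen : demands K N -> 'I_H -> nat)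
    (m : forall d h, files N B -> (rlen d h).-tuple bool) :
  (forall d k F F', c k F = c k F' ->
     (forall h, h \in conn k -> m d h F = m d h F') -> F (d k) = F' (d k)) ->
  exists s : scheme conn N B,
    [/\ forall k, exists e : cache_len s k = clen k,
          forall F, c k F = tcast e (cache s k F),
        relay_len s = rlen, forall d h k, link_len s d h k = rlen d h &
        forall d F k, decoded s d F k = F (d k)].
Proof.
move=> uniq_dec.
pose consistent d k (z : (clen k).-tuple bool)
    (y : forall h, h \in conn k -> (rlen d h).-tuple bool) F :=
  c k F = z /\ forall h (hk : h \in conn k), m d h F = y h hk.
pose dec d k z y := if pselect (exists F, @consistent d k z y F) is left e
  then projT1 (cid e) (d k) else [tuple false | _ < B].
exists (@Scheme H K conn N B clen c rlen m (fun d h _ => rlen d h)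
  (fun _ _ _ x => x) dec); split=> //.
  by move=> k; exists erefl => F; rewrite tcast_id.
move=> d F k; rewrite /decoded /= /dec.
case: pselect => [e|[]]; last by exists F.
by case: (cid e) => F' /= [h1 h2]; apply: uniq_dec => // h hk; apply: h2.
Qed.

(* A code describes the delivery phase, for Maddah-Ali--Niesen placement with
   parameter t. Every file is split into subfiles indexed by the t-subsets S of
   users, and every subfile into pieces; w J p is the integer
   \sum_(k in J) (piece p of the subfile J :\ k of the file demanded by k).
   Relay h sends the integers \sum_J \sum_p coef j J p * w J p for all j. *)
Record code (H K : nat) := Code {
  piece : finType;
  row : 'I_H -> finType;
  coef : forall h, row h -> {set 'I_K} -> piece -> int
}.

(** By linearity, [w] stands for the difference of the messages of two file families causing the
    same transmissions. A trivial kernel is enough for unique decoding. *)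
Definition decodable (H K : nat) (conn : 'I_K -> {set 'I_H}) (t : nat)
    (c : code H K) :=
  forall k (w : {set 'I_K} -> piece c -> int),
    (forall h (j : row c h), h \in conn k ->
       \sum_(J : {set 'I_K} | #|J| == t.+1) \sum_p coef j J p * w J p = 0) ->
  forall (J : {set 'I_K}) p, #|J| = t.+1 -> k \in J -> w J p = 0.

(** A crude bound on the growth of a row relative to one block, summed over all rows so that the
    same number of extra bits fits each of them. *)
Definition coef_weight H K t (c : code H K) : nat :=
  (\sum_h \sum_(j : row c h) \sum_(J : {set 'I_K} | #|J| == t.+1)
     \sum_p absz (coef j J p) * K)%N.

Lemma card_slots (n K : nat) (P : 'I_n -> finType) (L : 'I_n -> nat)
    (Q : 'I_n -> pred {set 'I_K}) :
  #|[pred s : {i : 'I_n & ({set 'I_K} * (P i * 'I_(L i)))%type} |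
       Q (tag s) (tagged s).1]|
  = (\sum_i #|Q i| * (#|P i| * L i))%N.
Proof.
rewrite -sum1_card.
rewrite -(sig_big_dep predT (fun i x => Q i x.1) (fun _ _ => 1%N)) /=.
apply: eq_bigr => i _; rewrite sum1_card.
rewrite (eq_card (B := [predX Q i & predT])); last first.
  by move=> x; rewrite !inE /= andbT.
by rewrite cardX card_prod card_ord.
Qed.

(** Counting the t-subsets that avoid [k] reduces this to [mul_bin_down]. It is why a user caches
    the fraction t / K of each file. *)
Lemma card_draws_with (K t : nat) (k : 'I_K) :
  (K * #|[pred S : {set 'I_K} | (#|S| == t) && (k \in S)]| = t * 'C(K, t))%N.
Proof.
have cdraws : #|[pred S : {set 'I_K} | #|S| == t]| = 'C(K, t).
  rewrite -[in RHS](card_ord K) -card_draws; apply: eq_card => S.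
  by rewrite !inE.
have cwithout :
    #|[pred S : {set 'I_K} | (#|S| == t) && (k \notin S)]| = 'C(K.-1, t).
  rewrite -[in K.-1](card_ord K) -(cardsC1 k) -cards_draws.
  by apply: eq_card => S; rewrite !inE -finset.setTD finset.subsetD1 finset.subsetT andbC.
have split : (#|[pred S : {set 'I_K} | (#|S| == t) && (k \in S)]|
    + #|[pred S : {set 'I_K} | (#|S| == t) && (k \notin S)]| = 'C(K, t))%N.
  rewrite -cdraws -[RHS](cardID (mem [pred S : {set 'I_K} | k \in S])).
  by congr (_ + _)%N; apply: eq_card => S; rewrite !inE // andbC.
have := mul_bin_down K t; rewrite -cwithout -split.
have [tK|Kt] := leqP t K; first by nia.
have := bin_small Kt; rewrite -split; nia.
Qed.

(** * Memory sharing between codes *)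

Section MemorySharing.
Variables (R : realType) (H K : nat) (conn : 'I_K -> {set 'I_H}) (N n : nat).
Variables (wt : 'I_n -> R) (t : 'I_n -> nat) (c : 'I_n -> code H K).
Variables (m : 'I_n -> nat) (B : nat).
Hypothesis wt_ge0 : forall i, 0 <= wt i.
Hypothesis wt_sum : \sum_i wt i = 1.
Hypothesis t_le : forall i, (t i <= K)%N.
Hypothesis piece_gt0 : forall i, (0 < #|piece (c i)|)%N.
Hypothesis row_le : forall i h, (#|row (c i) h| <= m i)%N.
Hypothesis c_dec : forall i, decodable conn (t i) (c i).

Let npieces i := ('C(K, t i) * #|piece (c i)|)%N.

(** Bits per block: component [i] gets the share [wt i] of a file, cut into [npieces i] equal
    blocks, rounded down. *)
Let L i : nat := Num.trunc (wt i * B%:R / (npieces i)%:R).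

Let npieces_gt0 i : 0 < (npieces i)%:R :> R.
Proof. by rewrite ltr0n muln_gt0 bin_gt0 t_le piece_gt0. Qed.

Let L_le i : (npieces i * L i)%:R <= wt i * B%:R.
Proof.
have : (L i)%:R <= wt i * B%:R / (npieces i)%:R.
  by rewrite truncn_le divr_ge0 ?mulr_ge0 // ltW.
by rewrite ler_pdivlMr // natrM mulrC.
Qed.

Let L_gt i : wt i * B%:R - (npieces i)%:R <= (npieces i * L i)%:R.
Proof.
have := truncnS_gt (wt i * B%:R / (npieces i)%:R).
rewrite ltr_pdivrMr // -natr1 -/(L i) natrM; lra.
Qed.

Let slot : finType :=
  {i : 'I_n & ({set 'I_K} * (piece (c i) * 'I_(L i)))%type}.

Let mkslot i (S : {set 'I_K}) p (b : 'I_(L i)) : slot :=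
  Tagged (fun i => ({set 'I_K} * (piece (c i) * 'I_(L i)))%type) (S, (p, b)).

Let stored : pred slot := [pred s : slot | #|(tagged s).1| == t (tag s)].

Let card_stored : #|stored| = (\sum_i npieces i * L i)%N.
Proof.
rewrite (card_slots (fun i => piece (c i)) L (fun i S => #|S| == t i)).
apply: eq_bigr => i _; rewrite mulnA; congr (_ * _ * _)%N.
rewrite -[K in 'C(K, _)]card_ord -card_draws.
by apply: eq_card => S; rewrite !inE.
Qed.

Let stored_le : (#|stored| <= B)%N.
Proof.
rewrite -(ler_nat R) card_stored natr_sum.
apply: le_trans (ler_sum _ (fun i _ => L_le i)) _.
by rewrite -mulr_suml wt_sum mul1r.
Qed.

Let leftover_le : (B - #|stored|)%:R <= (\sum_i npieces i)%:R :> R.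
Proof.
rewrite natrB // card_stored !natr_sum lerBlDr -big_split /=.
rewrite -[leLHS]mul1r -[X in X * _ <= _]wt_sum mulr_suml; apply: ler_sum => i _.
by have := L_gt i; lra.
Qed.

(** Stored slots label the first [#|stored|] bits of a file, in enumeration order. *)
Let slot_bit (f : B.-tuple bool) s := nth false f (index s (enum stored)).

Let symbol i (f : B.-tuple bool) S (p : piece (c i)) : nat :=
  enum_rank ([ffun b : 'I_(L i) => slot_bit f (mkslot S p b)]).

Let symbol_lt i f S (p : piece (c i)) : (symbol f S p < 2 ^ L i)%N.
Proof.
rewrite /symbol; apply: leq_trans (ltn_ord _) _.
by rewrite card_ffun card_bool card_ord.
Qed.

Let W i (d : demands K N) (F : files N B) (J : {set 'I_K}) (p : piece (c i)) : int :=
  \sum_(k in J) (symbol (F (d k)) (J :\ k) p)%:Z.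

Let rowval i h (j : row (c i) h) d F : int :=
  \sum_(J : {set 'I_K} | #|J| == (t i).+1) \sum_p coef j J p * W d F J p.

Let X i := coef_weight (t i) (c i).

(** A message is at most K times [2 ^ L i], hence a row at most [X i * 2 ^ L i], and
    [X i < 2 ^ X i]. *)
Let rowval_lt i h (j : row (c i) h) d F : `|rowval j d F| < (2 ^ (L i + X i))%N%:Z.
Proof.
have W_le J (p : piece (c i)) : `|W d F J p| <= (K * 2 ^ L i)%N%:Z :> int.
  rewrite /W; apply: le_trans (ler_norm_sum _ _ _) _.
  apply: (@le_trans _ _ (\sum_(k in J) (2 ^ L i)%N%:Z)).
    by apply: ler_sum => k _; rewrite ger0_norm // lez_nat; apply: ltnW; apply: symbol_lt.
  rewrite sumr_const; have := max_card (mem J); rewrite card_ord => JK.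
  by rewrite -mulr_natr natz mulrC -PoszM lez_nat leq_mul2r JK orbT.
have le_X : (\sum_(J : {set 'I_K} | #|J| == (t i).+1)
    \sum_p absz (coef j J p) * K <= X i)%N.
  rewrite /X /coef_weight (bigD1 h) //= (bigD1 j) //= -!addnA; exact: leq_addr.
apply: (@le_lt_trans _ _ (X i * 2 ^ L i)%N%:Z); last first.
  by rewrite ltz_nat expnD mulnC ltn_pmul2l ?expn_gt0 // ltn_expl.
apply: (@le_trans _ _ ((\sum_(J : {set 'I_K} | #|J| == (t i).+1)
    \sum_p absz (coef j J p) * K) * 2 ^ L i)%N%:Z).
  rewrite PoszM -natz natr_sum mulr_suml.
  apply: le_trans (ler_norm_sum _ _ _) _; apply: ler_sum => J _.
  rewrite natr_sum mulr_suml.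
  apply: le_trans (ler_norm_sum _ _ _) _; apply: ler_sum => p _.
  rewrite normrM natz PoszM -mulrA -PoszM abszE.
  exact: ler_wpM2l.
by rewrite lez_nat leq_mul2r le_X orbT.
Qed.

Let cidx (k : 'I_K) : finType :=
  ('I_N * {s : slot | stored s && (k \in (tagged s).1)})%type.

Let cache_of k (F : files N B) : #|cidx k|.-tuple bool :=
  bits_of (fun z : cidx k => slot_bit (F z.1) (val z.2)).

(** Besides its rows, every relay gets the leftover bits of all files, uncoded. *)
Let ridx (h : 'I_H) : finType :=
  ({i : 'I_n & (row (c i) h * 'I_(L i + X i).+1)} + 'I_N * 'I_(B - #|stored|))%type.

Let msg_of (d : demands K N) h (F : files N B) : #|ridx h|.-tuple bool :=
  bits_of (fun z : ridx h => match z with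
    | inl u => int_bits (L (tag u) + X (tag u)) (rowval (tagged u).1 d F) (tagged u).2
    | inr v => nth false (F v.1) (#|stored| + v.2)
    end).

Let decoding (d : demands K N) k F F' : cache_of k F = cache_of k F' ->
  (forall h, h \in conn k -> msg_of d h F = msg_of d h F') ->
  (exists h, h \in conn k) -> F (d k) = F' (d k).
Proof.
move=> /bits_of_inj ceq meq [h0 hk0].
have cached i (S : {set 'I_K}) f (p : piece (c i)) : #|S| = t i -> k \in S ->
    symbol (F f) S p = symbol (F' f) S p.
  move=> cS kS; congr (nat_of_ord (enum_rank _)); apply/ffunP => b; rewrite !ffunE.
  have st : stored (mkslot S p b) && (k \in (tagged (mkslot S p b)).1).
    by rewrite kS andbT; apply/eqP.
  exact: (ceq (f, exist _ (mkslot S p b) st)).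
have rows i h (j : row (c i) h) : h \in conn k -> rowval j d F = rowval j d F'.
  move=> /(meq _)/bits_of_inj e.
  apply: (@int_bits_inj (L i + X i)); rewrite ?rowval_lt //; apply/ffunP => b.
  exact: (e (inl (Tagged (fun i => (row (c i) h * 'I_(L i + X i).+1)%type) (j, b)))).
have WW i (J : {set 'I_K}) (p : piece (c i)) : #|J| = (t i).+1 -> k \in J -> W d F J p = W d F' J p.
  move=> cJ kJ; apply/eqP; rewrite -subr_eq0; apply/eqP.
  apply: (@c_dec i k (fun J p => W d F J p - W d F' J p) _ J p cJ kJ).
  move=> h j hk; have /eqP := rows i h j hk.
  rewrite -subr_eq0 => /eqP rw; rewrite -[RHS]rw /rowval -sumrB.
  apply: eq_bigr => J' _; rewrite -sumrB; apply: eq_bigr => p' _.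
  by rewrite mulrBr.
(* A block not cached by [k] is read off the message of [k |: S]: all its other terms belong to sets
   containing [k], hence are cached. *)
have symb i (S : {set 'I_K}) (p : piece (c i)) : #|S| = t i -> symbol (F (d k)) S p = symbol (F' (d k)) S p.
  move=> cS; have [kS|kS] := boolP (k \in S); first exact: cached.
  have := WW i (k |: S) p; rewrite cardsU1 kS cS setU11 => /(_ erefl isT).
  rewrite /W (bigD1 k) ?setU11 //= [RHS](bigD1 k) ?setU11 //=.
  rewrite setU1K // (eq_bigr (fun k' =>
    (symbol (F' (d k')) ((k |: S) :\ k') p)%:Z)) => [/addIr[]//|k'].
  rewrite !inE => /andP[/orP[/eqP->|k'S k'k]]; first by rewrite eqxx.
  rewrite cached //; last by rewrite !inE eq_sym k'k eqxx.
  by have := cardsD1 k' (k |: S); rewrite cardsU1 kS !inE k'S orbT cS => -[].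
apply: eq_from_tnth => b; rewrite !(tnth_nth false).
have [bs|bs] := ltnP b #|stored|; last first.
  have hb : (b - #|stored| < B - #|stored|)%N by rewrite ltn_sub2r // (leq_ltn_trans bs).
  have /bits_of_inj/(_ (inr (d k, Ordinal hb))) := meq h0 hk0.
  by rewrite /= subnKC.
pose s := enum_val (Ordinal bs).
have st : s \in stored by exact: enum_valP.
have idx : index s (enum stored) = b.
  by rewrite /s /enum_val index_uniq ?enum_uniq // -cardE.
have : slot_bit (F (d k)) s = slot_bit (F' (d k)) s; last by rewrite /slot_bit idx.
case: (s) st => i [S [p b']] /eqP/= cS.
have /val_inj/enum_rank_inj/ffunP/(_ b') := symb i S p cS.
by rewrite !ffunE.
Qed.

(** Bits per relay beyond the proportional load: the extra bits of the rows and the leftovers. It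
    does not depend on [B], so it vanishes after division by [B]. *)
Definition share_overhead : nat :=
  (\sum_i m i * (coef_weight (t i) (c i)).+1
   + N * \sum_i 'C(K, t i) * #|piece (c i)|)%N.

Let card_ridx_le h : #|ridx h|%:R <=
  (\sum_i wt i * ((m i)%:R / ('C(K, t i) * #|piece (c i)|)%:R)) * B%:R
  + share_overhead%:R.
Proof.
have -> : #|ridx h| = (\sum_i #|row (c i) h| * (L i + X i).+1
    + N * (B - #|stored|))%N.
  rewrite card_sum card_prod !card_ord; congr (_ + _)%N.
  rewrite card_tagged sumnE big_map big_enum; apply: eq_bigr => i _.
  by rewrite card_prod card_ord.
rewrite /share_overhead !natrD [X in _ <= X]addrA; apply: lerD; last first.
  by rewrite !natrM ler_wpM2l.
rewrite !natr_sum mulr_suml -big_split /=; apply: ler_sum => i _.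
have h1 : (#|row (c i) h| * (L i + X i).+1)%:R <=
    (m i)%:R * (L i)%:R + (m i * (X i).+1)%:R :> R.
  by rewrite -natrM -natrD ler_nat -mulnDr addnS leq_mul2r row_le orbT.
apply: (le_trans h1); rewrite lerD2r mulrAC [leRHS]mulrC -mulrA.
rewrite ler_wpM2l // mulrC ler_pdivlMr ?npieces_gt0 //.
by have := L_le i; rewrite natrM mulrC.
Qed.

Let card_cidx_le k : #|cidx k|%:R <=
  (\sum_i wt i * (N%:R * (t i)%:R / K%:R)) * B%:R.
Proof.
have K_gt0 : 0 < K%:R :> R by rewrite ltr0n; case: (K) k => // -[].
rewrite card_prod card_ord card_sig.
rewrite (eq_card (B := [pred s : slot | (#|(tagged s).1| == t (tag s))
   && (k \in (tagged s).1)])) //.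
rewrite (card_slots (fun i => piece (c i)) L
   (fun i S => (#|S| == t i) && (k \in S))).
rewrite natrM natr_sum mulr_sumr mulr_suml; apply: ler_sum => i _.
have -> : wt i * (N%:R * (t i)%:R / K%:R) * B%:R =
  N%:R * ((t i)%:R * (wt i * B%:R) / K%:R) by ring.
rewrite ler_wpM2l // ler_pdivlMr // -natrM mulnC mulnA card_draws_with.
by rewrite -!mulnA natrM ler_wpM2l // mulnA L_le.
Qed.

Lemma memory_sharing_scheme : (forall k, exists h, h \in conn k) -> (0 < B)%N ->
  exists s : scheme conn N B,
  [/\ uncoded_placement s,
      memory_ok (\sum_i wt i * (N%:R * (t i)%:R / K%:R)) s,
      error_prob R s = 0 &
      max_link_load R s <=
        \sum_i wt i * ((m i)%:R / ('C(K, t i) * #|piece (c i)|)%:R)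
        + share_overhead%:R / B%:R].
Proof.
move=> conn_n0 B_gt0.
have [s [hcache hrelay hlink hdec]] := @unique_decoding_scheme H K N B conn
  _ cache_of _ msg_of (fun d k F F' e1 e2 => decoding e1 e2 (conn_n0 k)).
exists s; split.
- move=> k; have [e hF] := hcache k.
  have idx_lt (x : {s : slot | stored s && (k \in (tagged s).1)}) :
      (index (val x) (enum stored) < B)%N.
    apply: leq_trans stored_le; rewrite cardE index_mem mem_enum.
    by have /andP[] := valP x.
  exists (fun i => let z : cidx k := enum_val (cast_ord e i) in
     (z.1, Ordinal (idx_lt z.2))) => F i /=.
  rewrite [RHS](tnth_nth false) /=.
  have := congr1 (fun u => tnth u (cast_ord e i)) (hF F).
  by rewrite /cache_of /bits_of tnth_mktuple tcastE cast_ord_comp cast_ord_id => <-.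
- by move=> k; have [e _] := hcache k; rewrite e; apply: card_cidx_le.
- rewrite /error_prob; apply: big1_idem => [|d _]; first exact: maxxx.
  rewrite (_ : [set F | _]%SET = finset.set0) ?cards0 ?mul0r //.
  apply/setP => F; rewrite !inE; apply/existsP => -[k]; rewrite hdec eqxx //.
have bound_ge0 : 0 <= \sum_i wt i * ((m i)%:R / ('C(K, t i) * #|piece (c i)|)%:R)
    + share_overhead%:R / B%:R.
  by rewrite addr_ge0 ?divr_ge0 // sumr_ge0 // => i _; rewrite mulr_ge0 ?divr_ge0.
rewrite /max_link_load; apply: bigmax_le => // d _; apply: bigmax_le => // h _.
apply: bigmax_le => // k _; rewrite hlink hrelay maxxx.
by rewrite ler_pdivrMr ?ltr0n // mulrDl divfK ?card_ridx_le // pnatr_eq0 -lt0n.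
Qed.

End MemorySharing.

Lemma memory_sharing (R : realType) (H K N n : nat) (conn : 'I_K -> {set 'I_H})
    (wt : 'I_n -> R) (t : 'I_n -> nat) (c : 'I_n -> code H K) (m : 'I_n -> nat) :
  (forall i, 0 <= wt i) -> \sum_i wt i = 1 ->
  (forall i, (t i <= K)%N) -> (forall i, (0 < #|piece (c i)|)%N) ->
  (forall i h, (#|row (c i) h| <= m i)%N) ->
  (forall i, decodable conn (t i) (c i)) ->
  (forall k, exists h, h \in conn k) ->
  achievable_uncoded conn N (\sum_i wt i * (N%:R * (t i)%:R / K%:R))
    (\sum_i wt i * ((m i)%:R / ('C(K, t i) * #|piece (c i)|)%:R)).
Proof.
move=> wt_ge0 wt_sum t_le piece_gt0 row_le c_dec conn_n0.
have sch B := cid (memory_sharing_scheme N wt_ge0 wt_sum t_le piece_gt0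
  row_le c_dec conn_n0 (ltn0Sn B)).
pose s B := projT1 (sch B); have hs B := projT2 (sch B).
set load := \sum_i wt i * ((m i)%:R / _) in hs *.
(* Files of n + 1 bits in the n-th scheme, to keep the size positive. *)
exists S, s; split.
- apply/cvgnyPge => A; near=> B0; apply: leqW; near: B0; exact: nbhs_infty_ge.
- by move=> B; have [] := hs B.
- rewrite (_ : (fun B => _) = fun=> 0); first exact: cvg_cst.
  by apply/funext => B; have [] := hs B.
set u := fun B => _.
pose C : R := (share_overhead N t c m)%:R.
have le_u B : (u B <= (load + C * B.+1%:R^-1)%:E)%E.
  by rewrite lee_fin; have [] := hs B.
have cv : ((load + C * B.+1%:R^-1)%:E @[B --> \oo] --> load%:E)%classic.
  apply: cvg_EFin; first exact: nearW.
  have : (load + C * B.+1%:R^-1 @[B --> \oo] --> load + C * 0)%classic.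
    apply: cvgD; first exact: cvg_cst.
    by apply: cvgM; [exact: cvg_cst | exact: cvg_harmonic].
  by rewrite mulr0 addr0.
have [_ <-] := cvg_limn_einf_sup cv.
rewrite !limn_esup_lim; apply: lee_lim; [exact: is_cvg_esups..|].
apply: nearW => B; apply: ge_ereal_sup => _ [k /= Bk <-].
by apply: (le_trans (le_u k)); apply: ereal_sup_ubound; exists k.
Unshelve. all: by end_near.
Qed.

(** * Symmetrization over the permutations of the relays *)

Lemma card_perms H : #|{: {perm 'I_H}}| = H`!.
Proof. by rewrite -card_Sn; apply: eq_card => s; rewrite !inE. Qed.

(** Right multiplication by a transposition matches the permutations taking two given values at [a],
    so all H values are equally frequent. *)
Lemma card_perm_at H (a h : 'I_H) :
  (#|[pred s : {perm 'I_H} | s a == h]| * H = H`!)%N.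
Proof.
have same (h' : 'I_H) :
    #|[pred s : {perm 'I_H} | s a == h']| = #|[pred s : {perm 'I_H} | s a == h]|.
  rewrite -!sum1_card (reindex_inj (mulIg (tperm h h'))) /=.
  by apply: eq_bigl => s; rewrite !inE permM (canF_eq (tpermK _ _)) tpermR.
rewrite -card_perms.
rewrite -[RHS]sum1_card (partition_big (fun s : {perm 'I_H} => s a) predT) //=.
rewrite (eq_bigr (fun=> #|[pred s : {perm 'I_H} | s a == h]|)).
  by rewrite sum_nat_const card_ord mulnC.
by move=> h' _; rewrite sum1_card same.
Qed.

(* A gadget delivers n pieces of the messages of all the images of a set J of
   users under the permutations s of the relays: w s a is piece a of the message
   of s J, and the row i stands for all its translates, the integer
   \sum_a gcoef i a * w (gperm i a * s) a being sent to relay s (gloc i). *)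
Record gadget (H n : nat) := Gadget {
  grow : finType;
  gloc : grow -> 'I_H;
  gperm : grow -> 'I_n -> {perm 'I_H};
  gcoef : grow -> 'I_n -> int
}.

(** Only the message of [J] itself has to be recovered, from the translates that land on relays of
    [k]; images of [J] follow by translation. *)
Definition serves (H K n : nat) (conn : 'I_K -> {set 'I_H}) (J : {set 'I_K})
    (g : gadget H n) :=
  forall k (w : {perm 'I_H} -> 'I_n -> int), k \in J ->
  (forall (i : grow g) (s : {perm 'I_H}), s (gloc i) \in conn k ->
     \sum_a gcoef i a * w (gperm i a * s)%g a = 0) ->
  forall a, w 1%g a = 0.

Section Symmetrization.
Variables (H r : nat) (conn : 'I_('C(H, r)) -> {set 'I_H}).
Hypothesis net : comb_network conn.
Let K := 'C(H, r).

Lemma conn_onto (A : {set 'I_H}) : #|A| == r -> exists k, conn k = A.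
Proof.
have [cinj ccard] := net.
have im : [set conn k | k : 'I_('C(H, r))]%SET = [set A : {set 'I_H} | #|A| == r]%SET.
  apply/eqP; rewrite eqEcard; apply/andP; split.
    by apply/fintype.subsetP => B /imsetP[k _ ->]; rewrite inE ccard.
  by rewrite card_draws card_imset // !card_ord.
move=> cA; have : A \in [set conn k | k : 'I_('C(H, r))]%SET by rewrite im inE.
by move=> /imsetP[k _ ->]; exists k.
Qed.

Lemma conn_image (s : {perm 'I_H}) k : exists k', conn k' = [set s h | h in conn k]%SET.
Proof. by apply: conn_onto; rewrite card_imset ?net.2 //; apply: perm_inj. Qed.

Let act s k := projT1 (cid (conn_image s k)).

Let conn_act s k : conn (act s k) = [set s h | h in conn k]%SET.
Proof. exact: projT2 (cid (conn_image s k)). Qed.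

Let actM s s' k : act (s * s')%g k = act s' (act s k).
Proof.
apply: net.1; rewrite !conn_act -imset_comp.
by apply: eq_imset => h; rewrite /= permM.
Qed.

Let act1 k : act 1%g k = k.
Proof.
apply: net.1; rewrite conn_act -[RHS]imset_id.
by apply: eq_imset => h; rewrite /= perm1.
Qed.

Let act_inj s : injective (act s).
Proof. by apply: (can_inj (g := act s^-1)%g) => k; rewrite -actM mulgV act1. Qed.

Let actS s (J : {set 'I_K}) : {set 'I_K} := [set act s k | k in J]%SET.

(** All translates of all gadgets are sent. Piece [(u, a)] of the message of [J] comes from the
    gadget of the preimage of [J] under [u], translated by [u]. The H! translates of a row are
    spread equally over the H relays. *)
Lemma symmetric_code n t (cost : {set 'I_K} -> nat) :
  (forall J : {set 'I_K}, #|J| = t.+1 ->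
     exists2 g : gadget H n, serves conn J g & #|grow g| = cost J) ->
  exists c : code H K,
    [/\ decodable conn t c, #|piece c| = (H`! * n)%N &
        forall h, (#|row c h| * H
                   = H`! * \sum_(J : {set 'I_K} | #|J| == t.+1) cost J)%N].
Proof.
move=> exg.
(* Sets of the wrong size get a gadget without rows, so that choice applies. *)
have exg' (J : {set 'I_K}) : exists g : gadget H n,
    #|J| = t.+1 -> serves conn J g /\ #|grow g| = cost J.
  have [/exg[g]|] := eqVneq #|J| t.+1; first by exists g.
  move=> /eqP nJ; exists (@Gadget H n void (fun v => match v with end)
    (fun v => match v with end) (fun v => match v with end)); by [].
have {exg exg'} [g hg] := choice exg'.
pose zrow := {J : {set 'I_K} & grow (g J)}.
pose rows (h : 'I_H) : finType := {y : {perm 'I_H} * zrow |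
  (#|tag y.2| == t.+1) && (y.1 (gloc (tagged y.2)) == h)}.
pose cf h (y : rows h) (J : {set 'I_K}) (p : {perm 'I_H} * 'I_n) : int :=
  let u := (gperm (tagged (val y).2) p.2 * (val y).1)%g in
  if (p.1 == u) && (J == actS u (tag (val y).2))
  then gcoef (tagged (val y).2) p.2 else 0.
exists (@Code H K ({perm 'I_H} * 'I_n)%type rows cf); split => /=.
- move=> k w w0 J [u a] cJ kJ.
  pose J0 := actS u^-1%g J.
  have act_J0 : actS u J0 = J.
    rewrite /actS -imset_comp -[RHS]imset_id; apply: eq_imset => k' /=.
    by rewrite -actM mulVg act1.
  have cJ0 : #|J0| = t.+1 by rewrite card_imset //; apply: act_inj.
  have [sv _] := hg J0 cJ0.
  (* The gadget of [J0] is applied to the messages translated by [u], for the user that [u] sends to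
     [k]. *)
  have := sv (act u^-1%g k)
    (fun u' a' => w (actS (u' * u)%g J0) ((u' * u)%g, a')).
  move=> /(_ (imset_f _ kJ)) sv'.
  have <- : w (actS (1 * u)%g J0) ((1 * u)%g, a) = w J (u, a) by rewrite mul1g act_J0.
  apply: sv' => i s hs.
  have hk : (s * u)%g (gloc i) \in conn k.
    have -> : k = act u (act u^-1%g k) by rewrite -actM mulVg act1.
    by rewrite permM conn_act imset_f.
  have yP : (#|tag (Tagged (fun J => grow (g J)) i)| == t.+1) &&
    ((s * u)%g (gloc i) == (s * u)%g (gloc i)) by rewrite /= cJ0 !eqxx.
  have := w0 _ (exist _ ((s * u)%g, Tagged (fun J => grow (g J)) i) yP : rows _) hk.
  rewrite /cf /= exchange_big /= => e; rewrite -[RHS]e.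
  transitivity (\sum_v \sum_b \sum_(J' : {set 'I_K} | #|J'| == t.+1)
    (if (v == gperm i b * (s * u))%g && (J' == actS (gperm i b * (s * u))%g J0)
     then gcoef i b else 0) * w J' (v, b)); last first.
    by rewrite pair_bigA; apply: eq_bigr => -[v b] _.
  rewrite exchange_big /=.
  apply: eq_bigr => b _; rewrite (bigD1 (gperm i b * (s * u))%g) //=.
  rewrite [X in _ = _ + X]big1 ?addr0 => [|v /negPf ->]; last first.
    by rewrite big1 // => J' _; rewrite mul0r.
  rewrite (bigD1 (actS (gperm i b * (s * u))%g J0)) /=; last first.
    by rewrite card_imset ?cJ0 //; apply: act_inj.
  rewrite !eqxx /= [X in _ = _ + X]big1 ?addr0 => [|J' /andP[_ /negPf ->]].
    by rewrite -mulgA.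
  by rewrite mul0r.
- by rewrite card_prod card_ord card_perms.
move=> h; rewrite card_sig -sum1_card.
rewrite (eq_bigl (fun y : {perm 'I_H} * zrow => predT y.1 &&
  ((#|tag y.2| == t.+1) && (y.1 (gloc (tagged y.2)) == h)))) //.
rewrite -(pair_big_dep predT (fun (s : {perm 'I_H}) (z : zrow) =>
  (#|tag z| == t.+1) && (s (gloc (tagged z)) == h)) (fun _ _ => 1%N)) /=.
rewrite (exchange_big_dep (fun z : zrow => #|tag z| == t.+1)) /=; last first.
  by move=> s z _ /andP[].
rewrite big_distrl big_distrr /=.
rewrite (eq_bigr (fun=> H`!)) => [|z cz]; last first.
  rewrite -(card_perm_at (gloc (tagged z)) h) -[in RHS]sum1_card; congr (_ * _)%N.
  by apply: eq_bigl => s; rewrite !inE cz.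
transitivity (\sum_(J : {set 'I_K} | #|J| == t.+1) \sum_(i : grow (g J)) H`!)%N.
  by rewrite sig_big_dep; apply: eq_bigl => z; rewrite andbT.
apply: eq_bigr => J /eqP cJ; rewrite sum_nat_const mulnC.
by have [_ <-] := hg J cJ.
Qed.

End Symmetrization.

(** * Gadgets: direct, MDS, concatenated, interference elimination *)

Section Gadgets.
Variables (H r K : nat) (conn : 'I_K -> {set 'I_H}).
Hypothesis card_conn : forall k, #|conn k| = r.

Lemma direct_gadget n (J : {set 'I_K}) h : (forall k, k \in J -> h \in conn k) ->
  exists2 g : gadget H n, serves conn J g & #|grow g| = n.
Proof.
move=> hJ; exists (@Gadget H n 'I_n (fun=> h) (fun _ _ => 1%g)
  (fun i a => (a == i)%:R)); last by rewrite card_ord.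
move=> k w kJ rows a; have := rows a 1%g; rewrite /= perm1 => /(_ (hJ k kJ)).
rewrite (bigD1 a) //= eqxx mul1r mul1g big1 ?addr0 // => b /negPf ->.
by rewrite mul0r.
Qed.

(* MDS coding: the row of relay h is a Vandermonde row, and every user sees r
   distinct relays. *)
Lemma mds_gadget (J : {set 'I_K}) : exists2 g : gadget H r, serves conn J g &
  #|grow g| = #|[set h : 'I_H | users_of conn h :&: J != finset.set0]%SET|.
Proof.
exists (@Gadget H r {h : 'I_H | (users_of conn h :&: J)%SET != finset.set0} val
  (fun _ _ => 1%g) (fun h a => (val h)%:R ^+ a)); last first.
  by rewrite card_sig; apply: eq_card => h; rewrite !inE.
move=> k w kJ rows.
(* The pieces are the coefficients of a polynomial of degree below r whose values at the relay
   numbers are the rows; r distinct roots make it zero. *)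
pose p := \poly_(b < r) (oapp (w 1%g) 0 (insub b)).
have root_p h : h \in conn k -> root p h%:R.
  move=> hk; have hJ : (users_of conn h :&: J)%SET != finset.set0.
    by apply/set0Pn; exists k; rewrite !inE hk.
  have := rows (exist _ h hJ) 1%g; rewrite /= perm1 => /(_ hk) e.
  rewrite /root horner_poly -[X in _ == X]e; apply/eqP; apply: eq_bigr => b _.
  by rewrite valK mulg1 mulrC.
have p0 : p = 0.
  apply/eqP/contraT => pn0.
  suff : (size [seq (h%:R : int) | h : 'I_H <- enum (conn k)] < size p)%N.
    by rewrite size_map -cardE card_conn ltnNge size_poly.
  apply: max_poly_roots => //.
    by apply/allP => _ /mapP[h hk ->]; apply: root_p; rewrite mem_enum in hk.
  rewrite map_inj_uniq ?enum_uniq // => h h' /eqP.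
  by rewrite eqr_nat => /eqP/val_inj.
move=> a; have := congr1 (fun q : {poly int} => q`_a) p0.
by rewrite coef_poly ltn_ord valK coef0.
Qed.

(* Relay h0 gets all the pieces. For k in J not connected to h0, with relays
   x_0, ..., x_(r-1), one more row adds the pieces a of the images of J under
   tperm h0 x_a. Its translate by tperm h0 x_a is sent to the relay x_a of k,
   and all its terms except the piece a of J were sent directly to other relays
   of k. *)
Lemma concatenated_gadget (J : {set 'I_K}) h0 :
  exists2 g : gadget H r, serves conn J g &
    #|grow g| = (r + #|(J :\: users_of conn h0)%SET|)%N.
Proof.
pose x k a := nth h0 (enum (conn k)) a.
exists (@Gadget H r ('I_r + {k : 'I_K | k \in (J :\: users_of conn h0)%SET})%type
  (fun=> h0)
  (fun i a => match i with inl _ => 1%g | inr k => tperm h0 (x (val k) a) end)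
  (fun i a => match i with inl b => (a == b)%:R | inr _ => 1 end)); last first.
  by rewrite card_sum card_ord card_sig.
move=> k w kJ rows.
have direct (s : {perm 'I_H}) a : s h0 \in conn k -> w s a = 0.
  move=> hs; have := rows (inl a) s hs.
  rewrite (bigD1 a) //= eqxx mul1r mul1g big1 ?addr0 // => b /negPf ->.
  by rewrite mul0r.
move=> a; have [hk|hk] := boolP (h0 \in conn k); first by apply: direct; rewrite perm1.
have kP : k \in (J :\: users_of conn h0)%SET by rewrite !inE hk.
have xk b : (b < r)%N -> x k b \in conn k.
  by move=> br; rewrite -mem_enum mem_nth // -cardE card_conn.
have := rows (inr (exist _ k kP)) (tperm h0 (x k a)).
rewrite /= tpermL => /(_ (xk a (ltn_ord a))).
rewrite (bigD1 a) //= mul1r tperm2 big1 ?addr0 // => b ba.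
(* For [b != a] the product of the two transpositions sends [h0] to [x k b], which the second one
   fixes, so piece [b] was sent directly to a relay of [k]. *)
rewrite mul1r direct // permM tpermL tpermD ?xk //.
  by apply: contraNneq hk => ->; apply: xk.
apply: contraNneq ba => e; rewrite -val_eqE /=.
by have := e; rewrite /x => /eqP; rewrite nth_uniq ?enum_uniq -?cardE ?card_conn // eq_sym.
Qed.

End Gadgets.

(* The 2r relays of H_k1 U H_k2 send vectors of dimension 2r - 1 whose sum is 0,
   and such that the vectors of the relays in pi_a H_k1 sum to a multiple of the
   a-th unit vector; hence so do those of the relays in pi_a H_k2. Such vectors
   exist because the indicators of the pi_a H_k1, restricted to the relays other
   than s0, are linearly independent. *)
Lemma elimination_gadget (H r K : nat) (conn : 'I_K -> {set 'I_H}) k1 k2 :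
  (1 < r)%N -> (forall k, #|conn k| = r) -> [disjoint conn k1 & conn k2] ->
  exists2 g : gadget H (2 * r - 1), serves conn [set k1; k2]%SET g &
    #|grow g| = (2 * r)%N.
Proof.
move=> r_gt1 card_conn dis.
have notin2 h : h \in conn k1 -> h \notin conn k2 by move=> /(disjointFr dis) ->.
have notin1 h : h \in conn k2 -> h \notin conn k1 by move=> /(disjointFl dis) ->.
have [u0 u0P] : exists u, u \in conn k1 by apply/card_gt0P; rewrite card_conn ltnW.
have [s0 [v0 [s0P v0P s0v0]]] : exists s v, [/\ s \in conn k2, v \in conn k2 & s != v].
  by apply/card_gt1P; rewrite card_conn.
pose A := ((conn k1 :|: conn k2) :\ s0)%SET.
have card_A : (2 * r - 1)%N = #|A|.
  have := cardsD1 s0 (conn k1 :|: conn k2)%SET; rewrite -/A !inE s0P orbT.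
  by rewrite cardsU disjoint_setI0 // cards0 !card_conn; lia.
pose x (j : 'I_(2 * r - 1)) : 'I_H := enum_val (cast_ord card_A j).
have xA j : x j \in A by apply: enum_valP.
have x_inj : injective x by move=> i j /enum_val_inj/cast_ord_inj.
have x_onto h : h \in A -> exists j, x j = h.
  move=> hA; exists (cast_ord (esym card_A) (enum_rank_in hA h)).
  by rewrite /x cast_ordKV enum_rankK_in.
(* Involutions fixing [s0]. The image of [conn k1] trades h for [v0] if h is in [conn k1], trades
   [u0] for h if h is another relay of [conn k2], and is [conn k1] itself for [v0]. *)
pose pi h := if h == v0 then 1%g else
  if h \in conn k1 then tperm h v0 else tperm u0 h.
have piK h h' : pi h (pi h h') = h'.
  by rewrite /pi; case: ifP => _; rewrite ?perm1 //; case: ifP => _; rewrite tpermK.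
have pipi h : (pi h * pi h = 1)%g by apply/permP => h'; rewrite permM piK perm1.
have pi_s0 h : h \in A -> pi h s0 = s0.
  rewrite !inE /pi => /andP[hs0 _]; case: eqP => _; first by rewrite perm1.
  case: ifP => _; first by rewrite tpermD // eq_sym.
  by rewrite tpermD //; apply: contraTneq u0P => ->; apply: notin1.
have pi_S h h' : h \in A -> h' \in A -> pi h h' \in conn k1 \/ pi h h' \in conn k2.
  rewrite !inE => /andP[_ hS] /andP[_ h'S]; apply/orP; rewrite /pi.
  case: eqP => _; first by rewrite perm1.
  by case: ifP => _; case: tpermP => // _; rewrite ?u0P ?v0P ?orbT.
pose X : 'M[int]_(2 * r - 1) := \matrix_(i, j) (pi (x i) (x j) \in conn k1)%:R.
have det_X : \det X != 0.
  (* A kernel vector is a function [y] on relays whose sum over each [pi h] image of [conn k1] is 0.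
     Comparing with the sum for [v0] shows that [y] is constant on [A]; then r times this constant
     is 0. *)
  rewrite -det_tr; apply/det0P => -[v /eqP vn0 vX]; apply: vn0.
  pose y h := \sum_j v 0 j * (x j == h)%:R.
  have y_x j : y (x j) = v 0 j.
    rewrite /y (bigD1 j) //= eqxx mulr1 big1 ?addr0 // => i ij.
    by rewrite (inj_eq x_inj) (negPf ij) mulr0.
  have sum_y h : h \in A -> \sum_(a in conn k1) y (pi h a) = 0.
    move=> /x_onto[i <-].
    have := congr1 (fun M : 'rV[int]_(2 * r - 1) => M 0 i) vX.
    rewrite !mxE => e; rewrite -[RHS]e /y exchange_big /=; apply: eq_bigr => j _.
    rewrite !mxE -mulr_sumr; congr (_ * _).
    have [pk|pk] := boolP (pi (x i) (x j) \in conn k1).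
      rewrite (bigD1 (pi (x i) (x j))) //= piK eqxx big1 ?addr0 // => a /andP[_].
      by move=> ne; case: eqP => // e'; move: ne; rewrite e' piK eqxx.
    rewrite big1 // => a ak; case: eqP => // e'; move: pk.
    by rewrite e' piK ak.
  have v0A : v0 \in A by rewrite !inE v0P orbT eq_sym s0v0.
  have sum0 : \sum_(a in conn k1) y a = 0.
    by rewrite -[RHS](sum_y v0) //; apply: eq_bigr => a _; rewrite /pi eqxx perm1.
  have swap u z : u \in conn k1 -> z \in conn k2 ->
      \sum_(a in conn k1) y (tperm u z a) = 0 -> y u = y z.
    move=> uk zk; rewrite (bigD1 u) //= tpermL => e.
    move: sum0; rewrite (bigD1 u) //= -[RHS]e.
    rewrite [X in _ + X = _](eq_bigr (fun a => y (tperm u z a))) => [/addIr//|a].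
    move=> /andP[ak au]; rewrite tpermD // 1?eq_sym //.
    by apply: contraTneq zk => <-; apply: notin2.
  have k1A u : u \in conn k1 -> u \in A.
    move=> uk; rewrite !inE uk andbT.
    by apply: contraTneq uk => ->; apply: notin1.
  have y1 u : u \in conn k1 -> y u = y v0.
    move=> uk; apply: swap => //; have := sum_y u (k1A u uk).
    by rewrite /pi uk; case: eqP uk v0P => // -> /notin2/negPf ->.
  have yA h : h \in A -> y h = y v0.
    move=> hA; have := hA; rewrite !inE => /andP[_ /orP[]]; first exact: y1.
    move=> hk; have [-> //|hv0] := eqVneq h v0.
    rewrite -(y1 u0 u0P); apply/esym/swap => //; have := sum_y h hA.
    by rewrite /pi (negPf hv0) (negPf (notin1 h hk)).
  have yv0 : y v0 = 0.
    move: sum0; rewrite (eq_bigr (fun=> y v0)) => [|a /y1 //].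
    rewrite sumr_const card_conn => /eqP; rewrite mulrn_eq0 => /orP[|/eqP//].
    by move=> /eqP r0; move: r_gt1; rewrite r0.
  by apply/rowP => j; rewrite mxE -y_x yA.
(* The adjugate inverts [X] up to the factor [\det X] with integer coefficients. *)
pose C := \adj X.
exists (@Gadget H (2 * r - 1) (option 'I_(2 * r - 1)) (oapp x s0)
  (fun _ a => pi (x a))
  (fun i a => if i is Some j then C j a else - \sum_j C j a)); last first.
  by rewrite card_option card_ord; lia.
move=> k w kJ rows a; pose s := pi (x a).
pose Z j := \sum_b C j b * w (pi (x b) * s)%g b.
have row_some j : s (x j) \in conn k -> Z j = 0 by move=> /(rows (Some j) s).
have row_none : s s0 \in conn k -> \sum_j Z j = 0.
  move=> hs; have e := rows None s hs; apply/eqP; rewrite -oppr_eq0; apply/eqP.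
  rewrite -[RHS]e /Z exchange_big /= -sumrN; apply: eq_bigr => b _.
  by rewrite mulNr mulr_suml.
have XZ : \sum_j X a j * Z j = \det X * w 1%g a.
  transitivity (\sum_b (X *m C) a b * w (pi (x b) * s)%g b).
    rewrite /Z; under eq_bigr do rewrite mulr_sumr.
    rewrite exchange_big /=; apply: eq_bigr => b _.
    by rewrite mxE mulr_suml; apply: eq_bigr => j _; rewrite mulrA.
  rewrite mul_mx_adj (bigD1 a) //= [X in _ + X]big1 => [|b ba].
    by rewrite addr0 mxE eqxx mulr1n pipi.
  by rewrite mxE eq_sym (negPf ba) mulr0n mul0r.
suff : \sum_j X a j * Z j = 0.
  by move=> /eqP; rewrite XZ mulf_eq0 (negPf det_X) => /eqP.
move: kJ; rewrite !inE => /orP[] /eqP ek; subst k.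
  rewrite big1 // => j _; rewrite mxE.
  have [pk|_] := boolP (pi (x a) (x j) \in conn k1); last by rewrite mul0r.
  by rewrite row_some ?mulr0.
(* User [k2] hears the relay [s0], which makes the sum of all [Z j] zero. It also hears every [Z j]
   outside the image of [conn k1], so the rest sums to 0. *)
rewrite -[RHS](row_none _) ?pi_s0 //; apply: eq_bigr => j _; rewrite mxE.
have [pk|pk] := boolP (pi (x a) (x j) \in conn k1); first by rewrite mul1r.
rewrite mul0r row_some //.
by have [pk'|//] := pi_S (x a) (x j) (xA a) (xA j); rewrite pk' in pk.
Qed.

(** * Loads of the three schemes *)

Lemma bigmin_leq (I : eqType) (s : seq I) m (F : I -> nat) i :
  i \in s -> (\big[minn/m]_(j <- s) F j <= F i)%N.
Proof.
elim: s => // j s IH; rewrite big_cons inE geq_min => /orP[/eqP ->|/IH ->].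
  by rewrite leqnn.
by rewrite orbT.
Qed.

(** Both sides count the ordered pairs of disjoint n-subsets of an m-set. *)
Lemma bin_mul_bin m n : ('C(m, n + n) * 'C(n + n, n) = 'C(m, n) * 'C(m - n, n))%N.
Proof.
have [nnm|mnn] := leqP (n + n) m; last first.
  have small : (m - n < n)%N by lia.
  by rewrite (bin_small mnn) (bin_small small) muln0.
have f1 := bin_fact nnm.
have f2 : ('C(n + n, n) * (n`! * n`!) = (n + n)`!)%N.
  by have := bin_fact (leq_addr n n); rewrite addnK.
have f3 : ('C(m, n) * (n`! * (m - n)`!) = m`!)%N by apply: bin_fact; lia.
have f4 : ('C(m - n, n) * (n`! * (m - (n + n))`!) = (m - n)`!)%N.
  by rewrite subnDA; apply: bin_fact; lia.
apply/eqP; rewrite -(eqn_pmul2r (m := n`! * (n`! * (m - (n + n))`!))%N); last first.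
  by rewrite !muln_gt0 !fact_gt0.
by apply/eqP; rewrite -f2 in f1; rewrite -f4 -f1 in f3; lia.
Qed.

Section Loads.
Variables (R : realType) (H r : nat) (conn : 'I_('C(H, r)) -> {set 'I_H}).
Hypothesis r_bounds : (1 <= r <= H)%N.
Hypothesis net : comb_network conn.
Local Notation K := 'C(H, r).

Let card_conn k : #|conn k| = r. Proof. exact: net.2. Qed.

Let H_gt0 : (0 < H)%N. Proof. by case/andP: r_bounds; apply: leq_trans. Qed.

Definition deliverable (t : nat) (L : R) := exists (c : code H K) (m : nat),
  [/\ (t <= K)%N, (0 < #|piece c|)%N, forall h, (#|row c h| <= m)%N,
      decodable conn t c & L = m%:R / ('C(K, t) * #|piece c|)%:R].

(** The symmetric code has H! n pieces and, at each relay, H! / H rows per unit of cost; H!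
    cancels. *)
Lemma deliverable_cost n t (cost : {set 'I_K} -> nat) : (0 < n)%N -> (t <= K)%N ->
  (forall J : {set 'I_K}, #|J| = t.+1 ->
     exists2 g : gadget H n, serves conn J g & #|grow g| = cost J) ->
  deliverable t ((\sum_(J : {set 'I_K} | #|J| == t.+1) (cost J)%:R / n%:R)
    / (H%:R * 'C(K, t)%:R)).
Proof.
move=> n_gt0 tK /(symmetric_code net)[c [dec pc rc]].
exists c, #|row c (Ordinal H_gt0)|; split=> //.
- by rewrite pc muln_gt0 fact_gt0.
- by move=> h; rewrite -(leq_pmul2r H_gt0) !rc.
have C_neq0 : 'C(K, t)%:R != 0 :> R by rewrite pnatr_eq0 -lt0n bin_gt0.
have H_neq0 : H%:R != 0 :> R by rewrite pnatr_eq0 -lt0n.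
have n_neq0 : n%:R != 0 :> R by rewrite pnatr_eq0 -lt0n.
have f_neq0 : H`!%:R != 0 :> R by rewrite pnatr_eq0 -lt0n fact_gt0.
have -> : #|row c (Ordinal H_gt0)|%:R =
    H`!%:R * (\sum_(J : {set 'I_K} | #|J| == t.+1) cost J)%:R / H%:R :> R.
  by rewrite -natrM -(rc (Ordinal H_gt0)) natrM mulfK.
rewrite pc !natrM natr_sum -mulr_suml; field.
by rewrite n_neq0 f_neq0 C_neq0.
Qed.

Lemma deliverable_DIS t : (t <= K)%N -> deliverable t (R_DIS R r conn t).
Proof.
move=> tK; have r_gt0 : (0 < r)%N by case/andP: r_bounds.
have r_neq0 : r%:R != 0 :> R by rewrite pnatr_eq0 -lt0n.
pose cost J := if relays_of_all conn J != finset.set0 then r else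
  #|[set h : 'I_H | users_of conn h :&: J != finset.set0]%SET|.
have -> : R_DIS R r conn t = (\sum_(J : {set 'I_K} | #|J| == t.+1)
    (cost J)%:R / r%:R) / (H%:R * 'C(K, t)%:R).
  congr (_ / _); rewrite [RHS](bigID (fun J => relays_of_all conn J != finset.set0)) /=.
  congr (_ + _).
    apply: eq_big => [J|J]; rewrite !inE // => /andP[_ hJ].
    by rewrite /cost hJ divff.
  apply: eq_big => [J|J]; rewrite !inE ?negbK // => /andP[_ hJ].
  by rewrite /cost hJ mulrC.
apply: deliverable_cost => // J _; rewrite /cost.
case: ifP => [/set0Pn[h hJ]|_]; last exact: mds_gadget.
apply: (@direct_gadget _ _ _ _ _ h) => k kJ.
by move: hJ; rewrite inE => /fintype.subsetP/(_ k kJ); rewrite inE.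
Qed.

Lemma min_outside_attained (J : {set 'I_K}) :
  exists h : 'I_H, #|(J :\: users_of conn h)%SET| = min_outside conn J.
Proof.
pose h0 := Ordinal H_gt0.
case: (@arg_minnP _ h0 predT (fun h => #|(J :\: users_of conn h)%SET|)) => // h _ hmin.
exists h; apply/eqP; rewrite eqn_leq /min_outside; apply/andP; split.
  apply: (big_ind (fun m => #|(J :\: users_of conn h)%SET| <= m)%N) => [|a b ha hb|h' _]; last exact: hmin.
    by apply: subset_leq_card; apply: finset.subsetDl.
  by rewrite leq_min ha.
by apply: bigmin_leq; rewrite mem_index_enum.
Qed.

Lemma deliverable_CICS t : (t <= K)%N -> deliverable t (R_CICS R r conn t).
Proof.
move=> tK; have r_gt0 : (0 < r)%N by case/andP: r_bounds.
have r_neq0 : r%:R != 0 :> R by rewrite pnatr_eq0 -lt0n.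
have -> : R_CICS R r conn t = (\sum_(J : {set 'I_K} | #|J| == t.+1)
    (r + min_outside conn J)%:R / r%:R) / (H%:R * 'C(K, t)%:R).
  rewrite mulr_suml; apply: eq_bigr => J _.
  by rewrite natrD [(r%:R + _) / _]mulrDl divff.
apply: (deliverable_cost (cost := fun J => r + min_outside conn J)%N) => // J _.
have [h <-] := min_outside_attained J; exact: concatenated_gadget.
Qed.

(** A relay of some member of [J] leaves at most t users of [J] outside. *)
Lemma R_CICS_le t : (t <= K)%N -> R_CICS R r conn t
  <= 'C(K, t.+1)%:R * ((1 + t%:R / r%:R) / (H%:R * 'C(K, t)%:R)).
Proof.
move=> tK; have r_gt0 : (0 < r)%N by case/andP: r_bounds.
have -> : 'C(K, t.+1)%:R * ((1 + t%:R / r%:R) / (H%:R * 'C(K, t)%:R)) =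
  \sum_(J : {set 'I_K} | #|J| == t.+1) ((1 + t%:R / r%:R) / (H%:R * 'C(K, t)%:R)) :> R.
  rewrite sumr_const -[K in 'C(K, t.+1)]card_ord -card_draws mulr_natl.
  by congr (_ *+ _); apply: eq_card => J; rewrite !inE.
apply: ler_sum => J /eqP cJ.
rewrite ler_wpM2r ?invr_ge0 ?mulr_ge0 // lerD2l ler_wpM2r ?invr_ge0 // ler_nat.
have /card_gt0P[k kJ] : (0 < #|J|)%N by rewrite cJ.
have /card_gt0P[h hk] : (0 < #|conn k|)%N by rewrite card_conn.
rewrite -ltnS -cJ /min_outside.
apply: leq_ltn_trans (bigmin_leq _ _ (mem_index_enum h)) _.
apply: proper_card; apply/properP; split; first exact: finset.subsetDl.
by exists k; rewrite // !inE hk.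
Qed.

Lemma card_disjoint_users k :
  #|[set k' | [disjoint conn k & conn k']]%SET| = 'C(H - r, r).
Proof.
have -> : (H - r = #|~: conn k|)%N by rewrite cardsCs finset.setCK card_ord card_conn.
rewrite -(card_imset _ net.1) -cards_draws; apply: eq_card => A; rewrite !inE.
apply/imsetP/andP => [[k' + ->]|[AC cA]].
  rewrite inE card_conn eqxx => dis; split=> //.
  by rewrite finset.subsetC -finset.disjoints_subset.
have [k' ek'] := conn_onto net cA; exists k' => //.
by rewrite inE ek' disjoint_sym finset.disjoints_subset.
Qed.

Lemma relays_of_pair k1 k2 : (relays_of_all conn [set k1; k2]%SET == finset.set0)
    = [disjoint conn k1 & conn k2].
Proof.
rewrite -setI_eq0; congr (_ == _); apply/setP => h; rewrite !inE.
by rewrite finset.subUset !finset.sub1set !inE.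
Qed.

(** Double counting of the pairs made of a set [J] and a member [k]: the other member is any user
    sharing no relay with [k]. *)
Lemma card_V2_1 : (#|V2 conn 1| * 2 = K * 'C(H - r, r))%N.
Proof.
have r_gt0 : (0 < r)%N by case/andP: r_bounds.
transitivity (\sum_(J in V2 conn 1) \sum_(k in J) 1)%N.
  rewrite -sum_nat_const; apply: eq_bigr => J; rewrite inE => /andP[/eqP cJ _].
  by rewrite sum1_card cJ.
rewrite (exchange_big_dep predT) //= (eq_bigr (fun=> 'C(H - r, r))).
  by rewrite sum_nat_const card_ord.
move=> k _; rewrite -(card_disjoint_users k) sum1_card.
rewrite -[RHS](card_in_imset (f := fun k' => [set k; k']%SET)); last first.
  move=> k1 k2; rewrite !inE => d1 d2 /setP/(_ k1); rewrite !inE eqxx orbT.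
  move=> /esym/orP[]/eqP // e; move: d1.
  by rewrite e -setI_eq0 finset.setIid -cards_eq0 card_conn eqn0Ngt r_gt0.
apply: eq_card => J; rewrite unfold_in /= !inE.
apply/andP/imsetP => [[/andP[/cards2P[k1 [k2 [k12 ->]]] +] +]|[k' + ->]].
  rewrite relays_of_pair !inE => dis /orP[]/eqP ->; first by exists k2; rewrite ?inE.
  by exists k1; [rewrite inE disjoint_sym | rewrite finset.setUC].
rewrite inE -relays_of_pair => dis; rewrite dis finset.set21 andbT; split=> //.
suff -> : #|[set k; k']%SET| = 2%N by [].
rewrite cards2; suff -> : k != k' by [].
apply: contraTneq dis => ->.
by rewrite relays_of_pair -setI_eq0 finset.setIid -cards_eq0 card_conn eqn0Ngt r_gt0.
Qed.

Lemma deliverable_IES : (1 < r)%N -> deliverable 1 (R_IES R H r K).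
Proof.
move=> r_gt1; have K_gt0 : (0 < K)%N by rewrite bin_gt0; case/andP: r_bounds.
pose cost J := if relays_of_all conn J != finset.set0 then (2 * r - 1)%N
  else (2 * r)%N.
have n_gt0 : (0 < 2 * r - 1)%N by lia.
have -> : R_IES R H r K = (\sum_(J : {set 'I_K} | #|J| == 2)
    (cost J)%:R / (2 * r - 1)%:R) / (H%:R * 'C(K, 1)%:R).
  rewrite (bigID (fun J => relays_of_all conn J != finset.set0)) /=.
  rewrite (eq_bigr (fun=> 1)) => [|J /andP[_ hJ]]; last first.
    by rewrite /cost hJ divff // pnatr_eq0 -lt0n.
  rewrite [X in _ + X](eq_bigr (fun=> (2 * r)%:R / (2 * r - 1)%:R)); last first.
    by move=> J /andP[_ /negPf hJ]; rewrite /cost hJ.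
  rewrite !sumr_const.
  have -> : #|[pred J : {set 'I_K} | (#|J| == 2) &&
      (relays_of_all conn J != finset.set0)]| = #|V1 conn 1|.
    by apply: eq_card => J; rewrite !inE.
  have -> : #|[pred J : {set 'I_K} | (#|J| == 2) &&
      ~~ (relays_of_all conn J != finset.set0)]| = #|V2 conn 1|.
    by apply: eq_card => J; rewrite !inE negbK.
  have V12 : (#|V1 conn 1| + #|V2 conn 1| = 'C(K, 2))%N.
    rewrite -[K in 'C(K, 2)]card_ord -card_draws.
    rewrite -[RHS](cardID (mem [pred J | relays_of_all conn J != finset.set0])).
    by congr (_ + _)%N; apply: eq_card => J; rewrite !inE ?negbK // andbC.
  have V1_1 : (#|V1 conn 1| * 2 + K * 'C(H - r, r) = K * K.-1)%N.
    by rewrite -card_V2_1 -mulnDl V12 mulnC -mul_bin_diag bin1.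
  (* Rewrites the number of disjoint pairs of users through the 2r-subsets of relays, the form used
     in [R_IES]. *)
  have bins : (K * 'C(H - r, r) * r
      = H * 'C(H.-1, (2 * r).-1) * 'C((2 * r).-1, r.-1))%N.
    rewrite -bin_mul_bin addnn -mul2n; have r2 : (0 < 2 * r)%N by lia.
    have := mul_bin_diag H (2 * r).-1; have := mul_bin_diag (2 * r) r.-1.
    rewrite !prednK // ?(ltnW r_gt1) // => e1 e2; rewrite e2 -mulnA.
    rewrite [(_ * 'C((2 * r).-1, r.-1))%N]mulnC; nia.
  have Hn0 : H%:R != 0 :> R by rewrite pnatr_eq0 -lt0n.
  have Kn0 : K%:R != 0 :> R by rewrite pnatr_eq0 -lt0n.
  have nn0 : (2 * r - 1)%:R != 0 :> R by rewrite pnatr_eq0 -lt0n.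
  have v2R := congr1 (fun a => a%:R : R) card_V2_1.
  have v1R := congr1 (fun a => a%:R : R) V1_1.
  have binsR := congr1 (fun a => a%:R : R) bins.
  rewrite /= !natrM natrD !natrM -subn1 natrB // in v1R.
  rewrite /= !natrM -!subn1 in v2R binsR.
  rewrite /R_IES bin1 -[1 *+ _]mulr_natl -[_ / _ *+ _]mulr_natr mulr1.
  have -> : #|V1 conn 1|%:R = (K%:R * (K%:R - 1) - K%:R * 'C(H - r, r)%:R) / 2 :> R.
    by rewrite -v1R; field.
  have -> : #|V2 conn 1|%:R = K%:R * 'C(H - r, r)%:R / 2 :> R.
    by rewrite -v2R; field.
  have c12 : 'C(2 * r - 1, r - 1)%:R * 'C(H - 1, 2 * r - 1)%:R
      = K%:R * 'C(H - r, r)%:R * r%:R / H%:R :> R by rewrite binsR; field.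
  rewrite [X in _ + X = _]mulrAC c12.
  rewrite natrM; field.
  by rewrite Kn0 nn0 Hn0.
apply: deliverable_cost => // J cJ; rewrite /cost.
case: ifP => [/set0Pn[h hJ]|].
  apply: (@direct_gadget _ _ _ _ _ h) => k kJ.
  by move: hJ; rewrite inE => /fintype.subsetP/(_ k kJ); rewrite inE.
move=> /negbFE; have /eqP/cards2P[k1 [k2 [_ ->]]] := cJ.
rewrite relays_of_pair => dis; exact: elimination_gadget.
Qed.

End Loads.

(** * The lower convex envelope *)

Theorem theorem1 (R : realType) (H r N : nat) (hr : (1 <= r <= H)%N)
    (conn : 'I_('C(H, r)) -> {set 'I_H}) (hconn : comb_network conn) :
  (forall M : R, 0 <= M <= N%:R ->
     (opt_load_uncoded conn N M
      <= lower_convex_envelope (memory_load_points r conn N) M)%E)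
  /\
  (forall t : nat, (t <= 'C(H, r))%N ->
     R_CICS R r conn t
     <= 'C('C(H, r), t.+1)%:R * ((1 + t%:R / r%:R) / (H%:R * 'C('C(H, r), t)%:R))).
Proof.
have r_gt0 : (0 < r)%N by case/andP: hr.
split=> [M _|t]; last exact: R_CICS_le.
have points p : memory_load_points r conn N p ->
    exists t, deliverable conn t p.2 /\ p.1 = N%:R * t%:R / 'C(H, r)%:R :> R.
  move=> [[[t tK ->]|[cond ->]]|[t tK ->]].
  - by exists t; split=> //; apply: deliverable_DIS.
  - exists 1%N; rewrite mulr1; split=> //; apply: deliverable_IES => //.
    (* The condition forces r > 1, as 1 is neither [p ^ v] with [0 < v] nor [p * q]. *)
    rewrite ltn_neqAle r_gt0 andbT; apply/eqP => r1; move: cond; rewrite -r1.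
    case=> [[a [v [/prime_gt1 p1 v0]]]|[a [q [/prime_gt1 p1 /prime_gt1 q1 _]]]] /=.
      by move=> e; have := ltn_expl v p1; rewrite -e; lia.
    nia.
  - by exists t; split=> //; apply: deliverable_CICS.
(* Memory sharing with weights [w] achieves each convex combination of the points. *)
apply: le_ereal_inf_tmp => _ /= [y [n [w [p [wp w1 <- <-]]]] <-].
apply: ereal_inf_lbound; exists (\sum_(i < n) w i * (p i).2) => //=.
have [t ht] := choice (fun i => points (p i) (wp i).2).
have [c hc] := choice (fun i => (ht i).1).
have [m hm] := choice hc.
have -> : \sum_(i < n) w i * (p i).1
    = \sum_(i < n) w i * (N%:R * (t i)%:R / 'C(H, r)%:R).
  by apply: eq_bigr => i _; rewrite (ht i).2.
have -> : \sum_(i < n) w i * (p i).2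
    = \sum_(i < n) w i * ((m i)%:R / ('C('C(H, r), t i) * #|piece (c i)|)%:R).
  by apply: eq_bigr => i _; case: (hm i) => _ _ _ _ ->.
apply: memory_sharing => // [i|i|i|i h|i|k]; try by case: (hm i).
  by case: (wp i).
by apply/card_gt0P; rewrite hconn.2.
Qed.
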